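(* For all integers $n\ge 1$ and $0\le m\le t(n)$, $$f_3(n,m)=\min\left\{\sum_{i=1}^k s(q_i):\ k,q_1,\ldots,q_k\in\mathbb N,\ \sum_{i=1}^k q_i=n,\ \sum_{i=1}^k t(q_i)\ge m\right\}.$$
   Context: All graphs are finite and simple; $\mathbb N$ denotes the positive integers. For a positive integer $q$, $t(q)=\lfloor q^2/4\rfloor$ and $s(q)=\lfloor (q-1)^2/4\rfloor$. For a triangle-free graph $G$, a non-edge $xy$ (an unordered pair of distinct non-adjacent vertices) is triangle-saturating if $G+xy$ contains a triangle. $f_3(G)$ is the number of triangle-saturating non-edges of $G$, and $f_3(n,m)$ is the minimum of $f_3(G)$ over all triangle-free graphs $G$ with $n$ vertices and $m$ edges. *)

(* Defs.v *)
From mathcomp Require Import all_boot.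

Set Implicit Arguments.
Unset Strict Implicit.
Unset Printing Implicit Defensive.

Record sgraph := SGraph {
  vertex :> finType;
  adj : rel vertex;
  adj_sym : symmetric adj;
  adj_irrefl : irreflexive adj
}.

Definition edges (G : sgraph) : {set {set G}} :=
  [set [set x; y] | x in G, y in G & adj x y].

(* The conjunct [u != v] makes G + xx equal to G, so that adding an edge is
   a total operation; it is only ever used for distinct x and y. *)
Definition add_adj (G : sgraph) (x y : G) : rel G :=
  fun u v => adj u v || (u != v) && ([set u; v] == [set x; y]).

Lemma add_adj_sym (G : sgraph) (x y : G) : symmetric (add_adj x y).
Proof. by move=> u v; rewrite /add_adj adj_sym eq_sym setUC. Qed.

Lemma add_adj_irrefl (G : sgraph) (x y : G) : irreflexive (add_adj x y).
Proof. by move=> u; rewrite /add_adj adj_irrefl eqxx. Qed.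

Definition add_edge (G : sgraph) (x y : G) : sgraph :=
  SGraph (add_adj_sym x y) (add_adj_irrefl x y).

Definition has_triangle (G : sgraph) : bool :=
  [exists x : G, exists y : G, exists z : G,
    [&& adj x y, adj y z & adj z x]].

Definition triangle_free (G : sgraph) : bool := ~~ has_triangle G.

Definition triangle_saturating (G : sgraph) (x y : G) : bool :=
  [&& x != y, ~~ adj x y & has_triangle (add_edge x y)].

(* Unordered pairs are two-element sets, so each non-edge counts once. *)
Definition f3_graph (G : sgraph) : nat :=
  #|[set [set x; y] | x in G, y in G & triangle_saturating x y]|.

Definition t (q : nat) : nat := (q ^ 2) %/ 4.
Definition s (q : nat) : nat := ((q - 1) ^ 2) %/ 4.

Definition is_minimum (A : nat -> Prop) (v : nat) : Prop :=
  A v /\ forall u, A u -> v <= u.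

(* [is_f3 n m v] says that f_3(n,m) is defined (some triangle-free graph with
   n vertices and m edges exists) and equals v. *)
Definition is_f3 (n m v : nat) : Prop :=
  is_minimum
    (fun u => exists G : sgraph,
       [/\ triangle_free G, #|G| = n, #|edges G| = m & u = f3_graph G])
    v.

(* Main.v *)
(* For a set [S] of vertices write m and p for the numbers of edges and of pairs
   at distance two of the induced subgraph; in a triangle-free graph the latter
   are the saturating pairs.  If [S] is connected and no edge [ab] dominates it
   (every vertex of [S] adjacent to [a] or [b]), then m <= p + 1: remove a
   non-cut vertex [v] having at least as many second neighbours as neighbours,
   and induct; if [S - v] has a dominating edge, it is bipartite with all pairs
   inside each side counted by p, and a direct count suffices.  The vertex [v]
   exists because, for an edge [ab] that does not dominate, one of [a], [b] has
   at least as many second neighbours as neighbours.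
   Since s(q + 1) = t(q), the largest q <= |S| with s(q) <= p then satisfies
   m <= t(q), and the partition (q, 1, ..., 1) handles [S]; if some edge
   dominates [S], the single part |S| does.  Components are added up.
   Conversely, deleting edges from a disjoint union of balanced complete
   bipartite graphs creates no new pair at distance two. *)
Require Import Defs.
From mathcomp Require Import all_boot zify.
From Stdlib Require Import Classical_Prop.

Set Implicit Arguments.
Unset Strict Implicit.
Unset Printing Implicit Defensive.

(** * Counting ordered pairs of a relation *)

Section OrderedPairs.
Variable T : finType.
Implicit Types (r : rel T) (A B : {set T}).

Definition nbr r B x := [set y in B | r x y].

(* Ordered pairs: on [A = B] this is twice the number of unordered pairs. *)
Definition npairs r A B := \sum_(x in A) #|nbr r B x|.

Lemma card_nbr r B x : #|nbr r B x| = \sum_(y in B) (r x y : nat).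
Proof.
rewrite -sum1_card big_mkcond [RHS]big_mkcond /=.
by apply: eq_bigr => y _; rewrite inE; case: (y \in B); case: (r x y).
Qed.

Lemma npairsE r A B : npairs r A B = \sum_(x in A) \sum_(y in B) (r x y : nat).
Proof. by apply: eq_bigr => x _; rewrite card_nbr. Qed.

Lemma npairsC r A B : symmetric r -> npairs r A B = npairs r B A.
Proof.
move=> rS; rewrite !npairsE exchange_big /=.
by apply: eq_bigr => x _; apply: eq_bigr => y _; rewrite rS.
Qed.

Lemma npairsUl r A B C :
  [disjoint A & B] -> npairs r (A :|: B) C = npairs r A C + npairs r B C.
Proof.
move=> dAB; rewrite /npairs -bigU //=.
by apply: eq_bigl => x; rewrite !inE.
Qed.

Lemma npairsU r A B : symmetric r -> [disjoint A & B] ->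
  npairs r (A :|: B) (A :|: B) = npairs r A A + npairs r B B + (npairs r A B).*2.
Proof.
move=> rS dAB; rewrite npairsUl // ![npairs r _ (A :|: B)]npairsC //.
by rewrite !npairsUl // [npairs r B A]npairsC // -addnn; lia.
Qed.

Lemma npairs1 r B x : npairs r [set x] B = #|nbr r B x|.
Proof. by rewrite /npairs big_set1. Qed.

Lemma npairsD1 r A x : symmetric r -> irreflexive r -> x \in A ->
  npairs r A A = npairs r (A :\ x) (A :\ x) + #|nbr r A x|.*2.
Proof.
move=> rS rI xA; rewrite -{1 2}(setD1K xA) npairsU ?disjoints1 ?inE ?eqxx //.
rewrite !npairs1; have -> : nbr r [set x] x = set0.
  by apply/setP => y; rewrite !inE; case: eqP => // ->; rewrite rI.
have -> : nbr r (A :\ x) x = nbr r A x.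
  by apply/setP => y; rewrite !inE; case: eqP => // ->; rewrite rI !andbF.
by rewrite cards0; lia.
Qed.

(** Removing a vertex changes the count by twice its degree. Parity later allows inequalities
    between ordered counts to be halved. *)
Lemma odd_npairs r A : symmetric r -> irreflexive r -> ~~ odd (npairs r A A).
Proof.
move=> rS rI; elim: {A}#|A| {-2}A (erefl #|A|) => [|k IH] A.
  by move/eqP; rewrite cards_eq0 => /eqP->; rewrite /npairs big_set0.
move=> Ak; have /set0Pn[x xA] : A != set0 by rewrite -card_gt0 Ak.
rewrite (npairsD1 rS rI xA) oddD odd_double addbF IH //.
by move: Ak; rewrite (cardsD1 x) xA => -[].
Qed.

Lemma leq_npairs r r' A B :
  {in A & B, forall x y, r x y -> r' x y} -> npairs r A B <= npairs r' A B.
Proof.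
move=> rr'; apply: leq_sum => x xA; apply/subset_leq_card/subsetP => y.
by rewrite !inE => /andP[yB rxy]; rewrite yB rr'.
Qed.

Lemma npairs0 r A B : {in A & B, forall x y, ~~ r x y} -> npairs r A B = 0.
Proof.
move=> nr; rewrite npairsE big1 // => x xA; rewrite big1 // => y yB.
by rewrite (negbTE (nr _ _ xA yB)).
Qed.

Lemma npairs_neq A : npairs (fun x y => x != y) A A = #|A| * #|A|.-1.
Proof.
rewrite -sum_nat_const; apply: eq_bigr => x xA; rewrite (cardsD1 x A) xA /=.
by congr #|pred_of_set _|; apply/setP => y; rewrite !inE eq_sym andbC.
Qed.

Lemma set2_inj (a b x y : T) : a != b -> [set a; b] = [set x; y] ->
  (a = x /\ b = y) \/ (a = y /\ b = x).
Proof.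
move=> nab eqs.
have /set2P Ha : a \in [set x; y] by rewrite -eqs set21.
have /set2P Hb : b \in [set x; y] by rewrite -eqs set22.
by case: Ha Hb nab => [->|->] [->|->]; rewrite ?eqxx //; auto.
Qed.

(** The map from ordered pairs to two-element sets has fibres of size exactly 2, by symmetry and
    irreflexivity. *)
Lemma card_unordered_pairs r : symmetric r -> irreflexive r ->
  #|[set [set x; y] | x in T, y in T & r x y]|.*2 = npairs r setT setT.
Proof.
move=> rS rI.
pose R := [set p : T * T | r p.1 p.2].
pose f (p : T * T) := [set p.1; p.2].
have -> : [set [set x; y] | x in T, y in T & r x y] = f @: R.
  apply/setP => E; apply/imset2P/imsetP.
    by case=> x y _ /=; rewrite inE => rxy ->; exists (x, y); rewrite ?inE.
  by case=> -[x y]; rewrite inE /= => rxy ->; exists x y; rewrite ?inE.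
have -> : npairs r setT setT = #|R|.
  rewrite npairsE -sum1_card.
  rewrite (eq_bigr (fun x => \sum_(y | r x y) 1)) => [|x _].
    by rewrite pair_big_dep /=; apply: eq_bigl => -[x y]; rewrite !inE.
  rewrite [RHS]big_mkcond /=.
  by apply: eq_big => [y|y _]; rewrite ?inE //; case: (r x y).
rewrite -[RHS]sum1_card (partition_big_imset f) /= -mul2n mulnC -sum_nat_const.
apply: eq_bigr => _ /imsetP[[x y] + ->]; rewrite inE /= => rxy.
have nxy : x != y by apply: contraTneq rxy => ->; rewrite rI.
rewrite sum1dep_card -(_ : #|[set (x, y); (y, x)]| = 2); last first.
  by rewrite cards2 xpair_eqE negb_and nxy.
congr #|pred_of_set _|; apply/setP => -[a b]; rewrite !inE /= !xpair_eqE.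
apply/orP/andP => [|[rab /eqP]].
  by case=> /andP[/eqP-> /eqP->]; rewrite ?[r y x]rS rxy; split; rewrite // /f //= setUC.
have nab : a != b by apply: contraTneq rab => ->; rewrite rI.
by case/(set2_inj nab) => -[-> ->]; rewrite !eqxx; auto.
Qed.

End OrderedPairs.

(** * Distance two, connectedness and cut vertices in a triangle-free relation *)

Section TriangleFree.
Variables (T : finType) (e : rel T).
Hypotheses (eS : symmetric e) (eI : irreflexive e).
Hypothesis e3F : forall x y z, e x y -> e y z -> ~~ e x z.
Implicit Types A S X Y : {set T}.

(** Only the midpoint is asked to lie in [S]; by [e3F], such [x] and [y] are non-adjacent. *)
Definition dist2 S x y := (x != y) && [exists z in S, e x z && e z y].

(** These are the nonempty unions of components of the graph induced on [S]. *)
Definition edge_closed S A := [&& A \subset S, A != set0 &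
  [forall a in A, forall y in S, e a y ==> (y \in A)]].

Definition conn S := [forall A, edge_closed S A ==> (A == S)].

Definition edge_dominated S := [exists x in S, exists y in S,
  e x y && [forall w in S, e x w || e y w]].

Lemma dist2S S : symmetric (dist2 S).
Proof.
move=> x y; rewrite /dist2 eq_sym; congr (_ && _); apply: eq_existsb => z.
by rewrite [e x z]eS [e z y]eS [e y z && _]andbC.
Qed.

Lemma dist2I S : irreflexive (dist2 S).
Proof. by move=> x; rewrite /dist2 eqxx. Qed.

Lemma dist2_intro S x y z : x != y -> z \in S -> e x z -> e z y -> dist2 S x y.
Proof.
by move=> nxy zS xz zy; rewrite /dist2 nxy; apply/exists_inP; exists z; rewrite ?xz.
Qed.

Lemma dist2W S A x y : A \subset S -> dist2 A x y -> dist2 S x y.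
Proof.
move=> /subsetP AS /andP[nxy /exists_inP[z zA /andP[xz zy]]].
exact: (dist2_intro nxy (AS _ zA)).
Qed.

Lemma nbr_neq x y z : e x y -> ~~ e x z -> y != z.
Proof. by move=> xy; apply: contraNneq => <-. Qed.

Lemma edge_closed_edge S A : conn S -> A \subset S -> A != set0 -> A != S ->
  exists x y, [/\ x \in A, y \in S, y \notin A & e x y].
Proof.
move=> /forallP/(_ A)/implyP cS AS A0 nAS.
have : ~~ edge_closed S A by apply: contra nAS.
rewrite /edge_closed AS A0 /= => /forall_inPn[x xA /forall_inPn[y yS]].
by rewrite negb_imply => /andP[exy yA]; exists x, y.
Qed.

Lemma edge_closedP S A a y :
  edge_closed S A -> a \in A -> y \in S -> e a y -> y \in A.
Proof.
case/and3P=> _ _ /forall_inP/(_ a) + aA => /(_ aA)/forall_inP/(_ y) + yS eay.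
by move=> /(_ yS)/implyP->.
Qed.

Lemma edge_closedC S A : edge_closed S A -> A != S -> edge_closed S (S :\: A).
Proof.
move=> cA; have /and3P[AS A0 _] := cA => nAS.
rewrite /edge_closed subsetDl setD_eq0 eqEsubset AS /= in nAS *.
rewrite nAS /=; apply/forall_inP => a /setDP[aS aA]; apply/forall_inP => y yS.
apply/implyP => eay; rewrite inE yS andbT; apply: contra aA => yA.
by apply: (edge_closedP cA yA aS); rewrite eS.
Qed.

(* A minimal set [A] that is cut off from the rest of [S] by one vertex [u]
   contains no cut vertex of [S]. *)
Lemma noncut_set S : conn S -> 1 < #|S| ->
  exists u A, [/\ u \in S, edge_closed (S :\ u) A &
                  {in A, forall w, conn (S :\ w)}].
Proof.
move=> cS; rewrite ltnNge => S1.
have /set0Pn[u0 u0S] : S != set0 by apply: contraNneq S1 => ->; rewrite cards0.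
pose sep (p : T * {set T}) := (p.1 \in S) && edge_closed (S :\ p.1) p.2.
have sep0 : sep (u0, S :\ u0).
  rewrite /sep /= u0S /edge_closed subxx /=; apply/andP; split.
    apply: contra S1; rewrite (cardsD1 u0 S) u0S => /eqP->.
    by rewrite cards0.
  by apply/forall_inP => a _; apply/forall_inP => y yS; rewrite yS implybT.
case: (arg_minnP (fun p : T * {set T} => #|p.2|) sep0) => -[u A] /andP[/= uS cA] Amin.
exists u, A; split=> // w wA; have /and3P[/subsetP AS _ _] := cA.
have /setD1P[nwu wS] := AS w wA.
apply/forallP => P; apply/implyP => cP; apply/negPn/negP => nP.
(* If [w] separates [S], one of [P] and its complement in [S :\ w] avoids [u]. *)
wlog uP : P cP nP / u \notin P => [W|].
  case: (boolP (u \in P)) => [uP|]; last exact: W.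
  apply: (W (S :\ w :\: P)); rewrite ?edge_closedC ?inE ?uP //.
  have /and3P[PS P0 _] := cP; apply: contraNneq P0 => E.
  apply/eqP/setP => x; rewrite inE; apply/negP => xP.
  by move: (subsetP PS _ xP); rewrite -E inE xP.
have /and3P[/subsetP PS P0 _] := cP.
have wP : w \notin P by apply/negP => /PS; rewrite !inE eqxx.
(* Otherwise some edge [ay] of [S] leaves [P :\: A]. Closedness of [A] in [S :\ u] keeps [y] out of
   [A], so [y] differs from [w], and closedness of [P] puts [y] back in [P :\: A]. *)
have PA : P \subset A.
  apply/negPn/negP => nPA.
  have [|||a [y [/setDP[aP aA] yS yPA eay]]] := @edge_closed_edge S (P :\: A) cS.
  - by apply/subsetP => x /setDP[/PS /setD1P[]].
  - by rewrite setD_eq0.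
  - by apply: contraTneq wS => <-; rewrite inE wA.
  have aS : a \in S by have /setD1P[] := PS _ aP.
  have nyA : y \notin A.
    apply: contra aA => yA; apply: (edge_closedP cA yA); rewrite 1?eS //.
    by rewrite !inE aS andbT; apply: contraNneq uP => <-.
  have : y \in P.
    apply: (edge_closedP cP aP) => //; rewrite !inE yS andbT.
    by apply: contraNneq nyA => ->.
  by apply/negP; rewrite inE nyA in yPA.
have := Amin (w, P); rewrite /sep /= wS cP leqNgt => /(_ isT) /negP; apply.
by apply: proper_card; rewrite properE PA; apply/subsetPn; exists w.
Qed.

(** * Finding a removable vertex *)

Lemma nbr_dist2_leq S a b : b \in S -> e a b -> #|nbr e S b| <= #|nbr (dist2 S) S a|.+1.
Proof.
move=> bS ab; have /subset_leq_card : nbr e S b \subset a |: nbr (dist2 S) S a.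
  apply/subsetP => w; rewrite !inE => /andP[wS bw].
  by case: eqVneq => //= nwa; rewrite wS (dist2_intro _ bS ab bw) // eq_sym.
by move/leq_trans; apply; rewrite cardsU1 -[leqRHS]add1n leq_add2r leq_b1.
Qed.

(** The vertex [y] is a second neighbour of [a] that is not a neighbour of [b], which saves the 1 of
    [nbr_dist2_leq] on the side of [a]. If [a] has no larger degree than [b], take [a]; otherwise
    the strict inequality of degrees saves the 1 for [b]. *)
Lemma undominated_edge S a b x y :
  a \in S -> b \in S -> x \in S -> y \in S -> e a b -> e a x -> e x y ->
  ~~ e b y -> a != y ->
  #|nbr e S a| <= #|nbr (dist2 S) S a| \/ #|nbr e S b| <= #|nbr (dist2 S) S b|.
Proof.
move=> aS bS xS yS ab ax xy nby nay.
have ba : e b a by rewrite eS.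
have fb := nbr_dist2_leq aS ba.
have fa : #|nbr e S b| <= #|nbr (dist2 S) S a|.
  have /subset_leq_card : nbr e S b \subset a |: (nbr (dist2 S) S a :\ y).
    apply/subsetP => w; rewrite !inE => /andP[wS bw].
    case: (eqVneq w a) => //= nwa; rewrite wS (nbr_neq bw nby).
    by rewrite (dist2_intro _ bS ab bw) // eq_sym.
  rewrite cardsU1 (cardsD1 y (nbr _ S a)) [y \in _]inE yS (dist2_intro nay xS ax xy).
  by move/leq_trans; apply; rewrite leq_add2r leq_b1.
by case: (leqP #|nbr e S a| #|nbr e S b|) => [le|lt]; [left|right]; lia.
Qed.

Lemma removable_vertex S : conn S -> 1 < #|S| -> ~~ edge_dominated S ->
  exists v, [/\ v \in S, conn (S :\ v) & #|nbr e S v| <= #|nbr (dist2 S) S v|].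
Proof.
move=> cS S1 dS; have [u [A [uS cA Anc]]] := noncut_set cS S1.
have /and3P[/subsetP AS /set0Pn[w wA] _] := cA.
have domP a b : a \in S -> b \in S -> e a b -> exists2 y, y \in S & ~~ e a y && ~~ e b y.
  move=> aS bS ab; have := dS; rewrite /edge_dominated => /exists_inPn/(_ a aS).
  move=> /exists_inPn/(_ b bS); rewrite ab /= => /forall_inPn[y yS].
  by rewrite negb_or; exists y.
(* Both ends of an edge [ab] inside [A] are non-cut. As [ab] does not dominate, connectedness yields
   the path required by [undominated_edge]. *)
case: (boolP [exists a in A, exists b in A, e a b]) => [|noE].
  case/exists_inP=> a aA /exists_inP[b bA ab].
  have /setD1P[_ aS] := AS a aA; have /setD1P[_ bS] := AS b bA.
  have ba : e b a by rewrite eS.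
  have [y0 y0S /andP[nay0 nby0]] := domP a b aS bS ab.
  have [|||x [y [xU yS]]] := @edge_closed_edge S (nbr e S a :|: nbr e S b) cS.
  - by rewrite subUset; apply/andP; split; apply/subsetP => z; rewrite inE => /andP[].
  - by apply/set0Pn; exists b; rewrite !inE bS ab.
  - by apply: contraTneq y0S => <-; rewrite !inE (negbTE nay0) (negbTE nby0) !andbF.
  rewrite !inE yS /= negb_or => /andP[nay nby] xy.
  case/setUP: xU; rewrite inE => /andP[xS xab].
    have nya : a != y by apply: contraNneq nby => <-.
    by case: (undominated_edge aS bS xS yS ab xab xy nby nya) => H;
      [exists a | exists b]; split; auto.
  have nyb : b != y by apply: contraNneq nay => <-.
  by case: (undominated_edge bS aS xS yS ba xab xy nay nyb) => H;
    [exists b | exists a]; split; auto.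
(* Now [A] spans no edge, so [w] is a leaf attached to [u], and one second neighbour is enough. *)
have /setD1P[nwu wS] := AS w wA; exists w; split=> //; first exact: Anc.
have nbrw y : y \in S -> e w y -> y = u.
  move=> yS wy; apply/eqP/negPn/negP => nyu.
  have yA : y \in A by apply: (edge_closedP cA wA) => //; rewrite !inE nyu.
  by case/negP: noE; apply/exists_inP; exists w => //; apply/exists_inP; exists y.
have wu : e w u.
  have [|||x [y [/set1P-> yS _ wy]]] := @edge_closed_edge S [set w] cS.
  - by rewrite sub1set.
  - by apply/set0Pn; exists w; rewrite inE.
  - by apply: contraTneq S1 => <-; rewrite cards1.
  by rewrite -(nbrw y).
have [y0 y0S /andP[nwy0 nuy0]] := domP w u wS uS wu.
have uw : e u w by rewrite eS.
have [|||x [y [xwu yS]]] := @edge_closed_edge S [set w; u] cS.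
- by rewrite subUset !sub1set wS.
- by apply/set0Pn; exists w; rewrite !inE eqxx.
- apply: contraTneq y0S => <-; rewrite !inE; apply/norP; split.
    by apply: contraNneq nuy0 => ->.
  by apply: contraNneq nwy0 => ->.
rewrite !inE negb_or => /andP[nyw nyu] xy.
have uy : e u y.
  by case/set2P: xwu xy => -> // /(nbrw y yS) E; rewrite E eqxx in nyu.
have : #|nbr (dist2 S) S w| > 0.
  by apply/card_gt0P; exists y; rewrite inE yS (dist2_intro _ uS wu uy) // eq_sym.
apply: leq_trans; rewrite -(cards1 u); apply/subset_leq_card/subsetP => z.
by rewrite !inE => /andP[zS /(nbrw z zS)->].
Qed.

(** * Adding a vertex to a set dominated by an edge *)

Lemma dominated_extension_arith n1 n2 x y z f E :
  0 < n1 <= x -> z < y -> E <= n1 * z + (x - n1) * y -> z <= f ->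
  (E + n1 + n2).*2 <= x * x.-1 + y * y.-1 + (n1 * n2 + f).*2 + 2.
Proof.
move=> /andP[n1gt0 n1x] zy leE zf.
have [c Ex] : exists c, x = n1 + c by exists (x - n1); lia.
have [d Ey] : exists d, y = z + d.+1 by exists (y - z).-1; lia.
have [a En] : exists a, n1 = a.+1 by exists n1.-1; lia.
(* This is [(x - y)(x - y - 1) >= 0] over the integers. *)
have sq : (x * y).*2 <= x * x.-1 + y * y.+1.
  case: (leqP x y) => [xy|yx].
    have [b ->] : exists b, y = x + b by exists (y - x); lia.
    by case: x {Ex n1x leE xy} => [|k] /=; nia.
  have [b ->] : exists b, x = y.+1 + b by exists (x - y.+1); lia.
  by rewrite /=; nia.
have E1 : n1 * z + (x - n1) * y + n1 + n1 * d = x * y.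
  by rewrite Ex addKn Ey; nia.
have : d <= n1 * d by nia.
have : n2 <= n1 * n2 by nia.
have : y * y.+1 = y * y.-1 + y.*2 by case: (y) => //= k; nia.
lia.
Qed.

(** Triangle-freeness makes the two neighbourhoods disjoint and independent, and all pairs inside
    one of them share the neighbour [y0] or [x0]. The larger set [S'] allows midpoints outside [S],
    such as a vertex being added. *)
Lemma dominated_bipartition S S' x0 y0 : S \subset S' ->
  x0 \in S -> y0 \in S -> e x0 y0 -> {in S, forall w, e x0 w || e y0 w} ->
  let X := nbr e S y0 in let Y := nbr e S x0 in
  [/\ S = X :|: Y, [disjoint X & Y], npairs e S S = (npairs e X Y).*2 &
      #|X| * #|X|.-1 + #|Y| * #|Y|.-1 + (npairs (dist2 S') X Y).*2
        <= npairs (dist2 S') S S].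
Proof.
move=> /subsetP SS x0S y0S xy dom X Y.
have XYdef : S = X :|: Y.
  apply/setP => w; rewrite [RHS]inE ![w \in nbr _ _ _]inE -andb_orr.
  by apply/idP/andP => [wS|[]//]; rewrite wS orbC dom.
have XYdisj : [disjoint X & Y].
  rewrite -setI_eq0; apply/eqP/setP => w; rewrite !inE.
  apply/negP => /andP[/andP[_ yw] /andP[_ xw]].
  by have := e3F xy yw; rewrite xw.
have side z A : z \in S -> {in A, forall w, e z w} ->
    npairs e A A = 0 /\ #|A| * #|A|.-1 <= npairs (dist2 S') A A.
  move=> zS zA; split.
    by apply: npairs0 => a b aA bA; apply: e3F (zA b bA); rewrite eS zA.
  rewrite -npairs_neq; apply: leq_npairs => a b aA bA nab.
  by apply: (dist2_intro nab (SS _ zS)); [rewrite eS|]; apply: zA.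
have [|X0 leX] := side y0 X y0S; first by move=> w; rewrite inE => /andP[].
have [|Y0 leY] := side x0 Y x0S; first by move=> w; rewrite inE => /andP[].
split=> //; first by rewrite XYdef npairsU // X0 Y0.
rewrite [in leqRHS]XYdef npairsU //; last exact: dist2S.
by rewrite leq_add2r leq_add.
Qed.

Lemma dominated_extension S v x0 y0 :
  v \in S -> x0 \in S :\ v -> y0 \in S :\ v -> e x0 y0 ->
  {in S :\ v, forall w, e x0 w || e y0 w} -> ~~ edge_dominated S ->
  nbr e (nbr e (S :\ v) y0) v != set0 ->
  npairs e S S <= npairs (dist2 S) S S + 2.
Proof.
move=> vS x0S y0S xy dom dS N0; have yx : e y0 x0 by rewrite eS.
have [XYdef XYdisj eXY dXY] := dominated_bipartition (subD1set S v) x0S y0S xy dom.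
move: XYdef XYdisj eXY dXY; set X := nbr e (S :\ v) y0; set Y := nbr e (S :\ v) x0.
move=> XYdef XYdisj eXY dXY; set N := nbr e X v; set N2 := nbr e Y v.
have XS w : w \in X -> w \in S by rewrite !inE => /andP[/andP[]].
have YS w : w \in Y -> w \in S by rewrite !inE => /andP[/andP[]].
rewrite (npairsD1 eS eI vS) (npairsD1 (@dist2S S) (@dist2I S) vS) eXY.
have NX : N \subset X by apply/subsetP => w; rewrite inE => /andP[].
have XN w : (w \in X) && (w \in N) = (w \in N).
  by rewrite andb_idl // => /(subsetP NX).
(* Every vertex of [N] reaches every vertex of [N2] through [v]. *)
have leN : #|N| * #|N2| <= npairs (dist2 S) X Y.
  rewrite -sum_nat_const /npairs (bigID (mem N) (mem X)) /=.
  apply: leq_trans (leq_addr _ _).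
  rewrite [leqRHS](eq_bigl _ _ XN).
  apply: leq_sum => w; rewrite inE => /andP[wX vw].
  apply/subset_leq_card/subsetP => w2; rewrite !inE => /andP[/andP[w2S xw2] vw2].
  rewrite w2S xw2 /=; apply: (dist2_intro _ vS) => //; last by rewrite eS.
  apply: contraTneq xw2 => <-; move: wX; rewrite inE => /andP[_ yw].
  exact: e3F xy yw.
have dv : #|nbr e S v| = #|N| + #|N2|.
  rewrite -cardsUI [N :&: N2](_ : _ = set0) ?cards0 ?addn0.
    apply: eq_card => w; rewrite [RHS]inE [in RHS]inE [w \in N2]inE -andb_orl.
    rewrite -in_setU -XYdef !inE; case: eqVneq => // ->.
    by rewrite eI andbF.
  apply/eqP; rewrite setI_eq0; apply: disjointWl (disjointWr _ XYdisj).
    by apply/subsetP => w; rewrite inE => /andP[].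
  by apply/subsetP => w; rewrite inE => /andP[].
(* These vertices of [Y] are reached from [v] through [N]. *)
pose Z := [set y in Y | [exists w in N, e w y]].
have leZ : #|Z| <= #|nbr (dist2 S) S v|.
  apply/subset_leq_card/subsetP => y; rewrite inE => /andP[yY /exists_inP[w wN wy]].
  move: wN; rewrite inE => /andP[wX vw]; rewrite inE (YS _ yY) /=.
  apply: (dist2_intro _ (XS _ wX) vw wy); apply: contraTneq yY => <-.
  by rewrite !inE eqxx.
have Ngt0 : 0 < #|N| by rewrite card_gt0.
have y0Y : y0 \in Y by rewrite inE y0S.
have Ygt0 : 0 < #|Y| by rewrite (cardsD1 y0) y0Y.
(* If [w] were adjacent to all of [Y], the edge between [w] and [y0] would dominate [S], including
   [v]. *)
have nbrNY w : w \in N -> #|nbr e Y w| < #|Y|.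
  rewrite inE => /andP[wX vw]; apply: proper_card; rewrite properE.
  apply/andP; split; first by apply/subsetP => y; rewrite inE => /andP[].
  apply: contra dS => /subsetP wY.
  have yw : e y0 w by move: wX; rewrite inE => /andP[].
  apply/exists_inP; exists w; first exact: XS.
  apply/exists_inP; exists y0; first exact: YS.
  rewrite eS yw /=; apply/forall_inP => a aS.
  case: (eqVneq a v) => [->|nav]; first by rewrite eS vw.
  have : a \in X :|: Y by rewrite -XYdef !inE nav.
  by case/setUP=> [|/wY]; rewrite inE => /andP[_ ->]; rewrite ?orbT.
have leE : npairs e X Y <= #|N| * minn #|Z| #|Y|.-1 + (#|X| - #|N|) * #|Y|.
  rewrite /npairs (bigID (mem N) (mem X)) /=; apply: leq_add.
    rewrite -sum_nat_const (eq_bigl _ _ XN).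
    apply: leq_sum => w wN; rewrite leq_min; apply/andP; split.
      apply/subset_leq_card/subsetP => y; rewrite !inE => /andP[-> wy] /=.
      by apply/exists_inP; exists w.
    by have := nbrNY w wN; lia.
  have -> : #|X| - #|N| = #|X :\: N| by rewrite cardsD (setIidPr NX).
  rewrite -sum_nat_const (eq_bigl (fun w => w \in X :\: N)) => [|w]; last by rewrite in_setD andbC.
  by apply: leq_sum => w _; apply/subset_leq_card/subsetP => y; rewrite inE => /andP[].
have ltz : minn #|Z| #|Y|.-1 < #|Y| by lia.
have lez : minn #|Z| #|Y|.-1 <= #|nbr (dist2 S) S v| by lia.
have rng : 0 < #|N| <= #|X| by rewrite Ngt0 subset_leq_card.
have := dominated_extension_arith #|N2| rng ltz leE lez; rewrite dv.
move: (#|X| * #|X|.-1) (#|Y| * #|Y|.-1) (#|N| * #|N2|) dXY leN.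
by clear=> a b c; lia.
Qed.

(** The bound [m <= p + 1] in ordered counts, hence the 2. *)
Lemma conn_edge_bound S : conn S -> S != set0 -> ~~ edge_dominated S ->
  npairs e S S <= npairs (dist2 S) S S + 2.
Proof.
move: {2}#|S| (leqnn #|S|) => k; elim: k S => [|k IH] S.
  by rewrite leqn0 cards_eq0 => ->.
move=> Sk cS S0 dS; case: (leqP #|S| 1) => [S1|S1].
  rewrite npairs0 // => x y xS yS.
  have /cards1P[z Sz] : #|S| == 1 by rewrite eqn_leq S1 card_gt0.
  by move: xS yS; rewrite Sz => /set1P-> /set1P->; rewrite eI.
have [v [vS cv dv]] := removable_vertex cS S1 dS.
have Sv0 : S :\ v != set0 by rewrite -card_gt0; move: S1; rewrite (cardsD1 v) vS.
case: (boolP (edge_dominated (S :\ v))) => [|dSv].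
  case/exists_inP=> x0 x0S /exists_inP[y0 y0S /andP[xy /forall_inP dom]].
  have [|||v' [w [/set1P-> wS nwv vw]]] := @edge_closed_edge S [set v] cS.
  - by rewrite sub1set.
  - by apply/set0Pn; exists v; rewrite inE.
  - by apply: contraTneq S1 => <-; rewrite cards1.
  have wSv : w \in S :\ v by rewrite !inE wS andbT -in_set1.
  (* [dominated_extension] wants a neighbour of [v] on the side of the neighbours of its second
     endpoint, so the ends are swapped when [w] is adjacent to [x0]. *)
  case/orP: (dom w wSv) => H.
    apply: (@dominated_extension S v y0 x0) => //; first by rewrite eS.
      by move=> z zS; rewrite orbC dom.
    by apply/set0Pn; exists w; rewrite inE vw inE wSv H.
  apply: (@dominated_extension S v x0 y0) => //.
  by apply/set0Pn; exists w; rewrite inE vw inE wSv H.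
have Svk : #|S :\ v| <= k by move: Sk; rewrite (cardsD1 v) vS.
have := IH _ Svk cv Sv0 dSv.
rewrite (npairsD1 eS eI vS) (npairsD1 (@dist2S S) (@dist2I S) vS).
have := @leq_npairs _ (dist2 (S :\ v)) (dist2 S) (S :\ v) (S :\ v).
by move=> /(_ (fun x y _ _ => @dist2W S _ x y (subD1set S v))); lia.
Qed.

(** * From the edge bound to partitions *)

Lemma leq_t_mul x y : x * y <= t (x + y).
Proof. by rewrite /t leq_divRL // mulnC; have [->] := nat_AGM2 x y. Qed.

(** The number of pairs inside two sides of given total size is least for a balanced split, where it
    equals [s]. *)
Lemma leq_s_mul x y : (s (x + y)).*2 <= x * x.-1 + y * y.-1.
Proof.
rewrite /s -mulnn; have := leq_divM ((x + y - 1) * (x + y - 1)) 4.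
move: (_ %/ 4) => u leu.
case: x leu => [|x]; case: y => [|y] /=; rewrite ?add0n ?addn0 ?subn0; try by nia.
rewrite addSn subn1 /= => leu.
case: (ltngtP x y) => [xy|yx|exy]; last by subst; nia.
  have [d Ed] : exists d, y = x + d.+1 by exists (y - x).-1; lia.
  by subst; nia.
have [d Ed] : exists d, x = y + d.+1 by exists (x - y).-1; lia.
by subst; nia.
Qed.

Lemma sS q : s q.+1 = t q.
Proof. by rewrite /s subn1. Qed.

Lemma npairs_edge_dist2 S :
  npairs e S S + npairs (dist2 S) S S <= #|S| * #|S|.-1.
Proof.
rewrite -npairs_neq !npairsE -big_split; apply: leq_sum => x xS /=.
rewrite -big_split; apply: leq_sum => y yS /=.
case: eqVneq => [->|nxy]; first by rewrite eI dist2I.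
case: (boolP (dist2 S x y)) => [|_]; last by case: (e x y).
by case/andP=> _ /exists_inP[z _ /andP[xz zy]]; rewrite (negbTE (e3F xz zy)).
Qed.

Lemma conn_part S : conn S -> S != set0 -> exists2 q, 0 < q <= #|S| &
  npairs e S S <= (t q).*2 /\ (s q).*2 <= npairs (dist2 S) S S.
Proof.
move=> cS S0; have Sgt0 : 0 < #|S| by rewrite card_gt0.
case: (boolP (edge_dominated S)) => [|dS].
  case/exists_inP=> x xS /exists_inP[y yS /andP[xy /forall_inP dom]].
  have [/= SE dXY -> leP] := dominated_bipartition (subxx S) xS yS xy dom.
  exists #|S|; first by rewrite Sgt0 leqnn.
  have -> : #|S| = #|nbr e S y| + #|nbr e S x|.
    rewrite [LHS](congr1 (fun A : {set T} => #|A|) SE).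
    by apply/eqP; rewrite (leq_card_setU _ _).2.
  split; last by apply: leq_trans (leq_s_mul _ _) (leq_trans (leq_addr _ _) leP).
  rewrite leq_double (leq_trans _ (leq_t_mul _ _)) // -sum_nat_const.
  by apply: leq_sum => w _; apply/subset_leq_card/subsetP => z; rewrite inE => /andP[].
have leM := conn_edge_bound cS S0 dS.
pose ok q := (0 < q <= #|S|) && ((s q).*2 <= npairs (dist2 S) S S).
have ok1 : exists q, ok q by exists 1; rewrite /ok Sgt0.
have okS q : ok q -> q <= #|S| by case/andP=> /andP[].
case: (ex_maxnP ok1 okS) => q /andP[q_rng leP] qmax; exists q => //; split=> //.
case: (ltngtP q #|S|) q_rng => [ltq|gtq|->] /andP[q0 //].
  (* Maximality gives [p < s q.+1 = t q], hence [m <= p + 1 <= t q]; parity passes from ordered to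
     unordered counts. *)
  have : ~~ ok q.+1 by apply/negP => /qmax; rewrite ltnn.
  have := odd_npairs S (@dist2S S) (@dist2I S).
  by rewrite /ok ltq /= sS; lia.
(* Here [q] is all of [#|S|], and [m <= p + 1] is added to the bound of [npairs_edge_dist2] on
   [m + p]. *)
rewrite -[npairs e S S]even_halfK ?(negbTE (odd_npairs _ _ _)) //.
rewrite leq_double /t leq_divRL // => _.
have := odd_npairs S eS eI; have := npairs_edge_dist2 S; move: leM Sgt0.
move: (npairs (dist2 S) S S) (npairs e S S) => P M.
by case: #|S| => [|[|n]] //=; rewrite -mulnn; nia.
Qed.

(** Induction splits off a proper edge-closed subset: no edge crosses the split, and enlarging the
    set of midpoints only adds pairs at distance two. *)
Lemma partition_bound S : exists l : seq nat,
  [/\ all (leq 1) l, sumn l = #|S|, npairs e S S <= (\sum_(q <- l) t q).*2 &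
      (\sum_(q <- l) s q).*2 <= npairs (dist2 S) S S].
Proof.
move: {2}#|S| (leqnn #|S|) => k; elim: k S => [|k IH] S.
  rewrite leqn0 cards_eq0 => /eqP->; exists [::].
  by rewrite cards0 !big_nil /npairs !big_set0.
move=> Sk; have [->|S0] := eqVneq S set0.
  by exists [::]; rewrite cards0 !big_nil /npairs !big_set0.
case: (boolP (conn S)) => [cS|].
  have [q /andP[q0 qS] [leM leP]] := conn_part cS S0.
  (* The filling parts of size 1 cost nothing, as [t 1 = s 1 = 0]. *)
  exists (q :: nseq (#|S| - q) 1); rewrite !big_cons /= q0 all_nseq orbT.
  have one (F : nat -> nat) : F 1 = 0 -> \sum_(i <- nseq (#|S| - q) 1) F i = 0.
    by move=> F1; apply: big1_seq => i /andP[_ /nseqP[-> _]].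
  by rewrite !one // !addn0 sumn_nseq mul1n subnKC.
case/forallPn=> A; rewrite negb_imply => /andP[cA nAS].
have /and3P[AS A0 _] := cA; have cB := edge_closedC cA nAS.
have B0 : S :\: A != set0 by have /and3P[] := cB.
have cardS : #|A| + #|S :\: A| = #|S| by rewrite -(cardsID A S) (setIidPr AS).
have [Ak Bk] : #|A| <= k /\ #|S :\: A| <= k.
  by move: A0 B0; rewrite -!card_gt0; lia.
have [l1 [p1 n1 M1 P1]] := IH A Ak; have [l2 [p2 n2 M2 P2]] := IH _ Bk.
have dAB : [disjoint A & S :\: A].
  by rewrite -setI_eq0; apply/eqP/setP => x; rewrite !inE; case: (_ \in A).
have SE : S = A :|: S :\: A by rewrite setDE setUIr setUCr setIT (setUidPr AS).
exists (l1 ++ l2); rewrite all_cat p1 p2 sumn_cat n1 n2 !big_cat /= !doubleD.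
have AB0 : npairs e A (S :\: A) = 0.
  apply: npairs0 => a b aA /setDP[bS bA]; apply: contra bA.
  exact: edge_closedP cA aA bS.
have mono A' : A' \subset S -> npairs (dist2 A') A' A' <= npairs (dist2 S) A' A'.
  by move=> A'S; apply: leq_npairs => x y _ _; apply: dist2W.
have := mono A AS; have := mono _ (subsetDl S A) => monoB monoA.
have := npairsU eS dAB; have := npairsU (@dist2S S) dAB; rewrite -SE AB0 => PS MS.
by split=> //; lia.
Qed.

End TriangleFree.

(** * Saturating pairs of graphs and the lower bound *)

Definition partition_cost n m u := exists (k : nat) (q : 'I_k -> nat),
  [/\ 0 < k /\ (forall i, 0 < q i), \sum_(i < k) q i = n,
      m <= \sum_(i < k) t (q i) & u = \sum_(i < k) s (q i)].

Lemma triangle_freeP (G : sgraph) : triangle_free G ->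
  forall x y z : G, adj x y -> adj y z -> ~~ adj x z.
Proof.
move=> tf x y z xy yz; apply: contra tf => xz.
apply/existsP; exists x; apply/existsP; exists y; apply/existsP; exists z.
by rewrite xy yz adj_sym.
Qed.

(** A triangle of [G + xy] must use the new edge, since [G] has none, and its third vertex is then a
    common neighbour of [x] and [y] in [G]. *)
Lemma triangle_saturatingE (G : sgraph) (x y : G) : triangle_free G ->
  triangle_saturating x y = dist2 (@adj G) setT x y.
Proof.
move=> tf; apply/and3P/idP => [[nxy _]|/andP[nxy /exists_inP[z _ /andP[xz zy]]]].
  have apex a b c : (a != b) && ([set a; b] == [set x; y]) ->
      add_adj x y b c -> add_adj x y c a -> dist2 (@adj G) setT x y.
    case/andP=> nab /eqP abxy bc ca.
    (* With [ab] the new edge, an edge at [c] cannot be new: its end [c] would be [a] or [b],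
       contradicting [ca] or [bc]. *)
    have old p : add_adj x y p c -> adj p c.
      case/orP: {1}(bc) => [bc'|/andP[nbc /eqP bcxy]]; last first.
        have : c \in [set a; b] by rewrite abxy -bcxy set22.
        case/set2P => cE; first by rewrite cE add_adj_irrefl in ca.
        by rewrite cE eqxx in nbc.
      rewrite /add_adj => /orP[//|/andP[npc /eqP pcxy]].
      have : c \in [set a; b] by rewrite abxy -pcxy set22.
      case/set2P => cE; first by rewrite cE add_adj_irrefl in ca.
      by rewrite cE adj_irrefl in bc'.
    have bc' := old b bc.
    have ac' : adj a c by apply: old; rewrite add_adj_sym.
    have : dist2 (@adj G) setT a b by apply: (dist2_intro nab _ ac'); rewrite // adj_sym.
    by case: (set2_inj nab abxy) => -[-> ->] //; rewrite dist2S //; apply: adj_sym.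
  case/existsP=> a /existsP[b /existsP[c /and3P[/= ab bc ca]]].
  case/orP: {1}(ab) => [ab'|new]; last exact: apex new bc ca.
  case/orP: {1}(bc) => [bc'|new]; last exact: apex new ca ab.
  case/orP: {1}(ca) => [ca'|new]; last exact: apex new ab bc.
  by move: (triangle_freeP tf ab' bc'); rewrite adj_sym ca'.
split=> //; first exact: triangle_freeP tf _ _ _ xz zy.
apply/existsP; exists x; apply/existsP; exists y; apply/existsP; exists z.
by rewrite /= /add_adj eqxx nxy [adj y z]adj_sym zy [adj z x]adj_sym xz !orbT.
Qed.

Lemma double_edges (G : sgraph) : #|edges G|.*2 = npairs (@adj G) setT setT.
Proof. exact: card_unordered_pairs (@adj_sym G) (@adj_irrefl G). Qed.

Lemma double_f3 (G : sgraph) : triangle_free G ->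
  (f3_graph G).*2 = npairs (dist2 (@adj G) setT) setT setT.
Proof.
move=> tf; rewrite -card_unordered_pairs; last exact: dist2I.
  congr (_.*2); apply: eq_card => E; apply/imset2P/imset2P => -[x y xG].
    by rewrite inE /= triangle_saturatingE // => xy ->; exists x y; rewrite ?inE.
  by rewrite inE /= => xy ->; exists x y; rewrite ?inE //= triangle_saturatingE.
by apply: dist2S; apply: adj_sym.
Qed.

Lemma partition_cost_of_graph (G : sgraph) : triangle_free G -> 0 < #|G| ->
  exists2 u, partition_cost #|G| #|edges G| u & u <= f3_graph G.
Proof.
move=> tf G0; have tf' := triangle_freeP tf.
have [l [pl nl Ml Pl]] := partition_bound (@adj_sym G) (@adj_irrefl G) tf' setT.
exists (\sum_(i < size l) s (nth 0 l i)); last first.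
  by rewrite -leq_double double_f3 // (leq_trans _ Pl) // (big_nth 0) big_mkord.
exists (size l), (fun i => nth 0 l i); split=> //.
- split; first by move: nl; rewrite cardsT; case: (l) => // E; rewrite -E in G0.
  by move=> i; apply: (allP pl); apply: mem_nth.
- by rewrite -cardsT -nl sumnE (big_nth 0) big_mkord.
- by move: Ml; rewrite -double_edges leq_double (big_nth 0) big_mkord.
Qed.

(** * Counting pairs in balanced complete bipartite graphs *)

Lemma sum_double (I : finType) (F : I -> nat) :
  (\sum_i F i).*2 = \sum_i (F i).*2.
Proof. by rewrite -mul2n big_distrr; apply: eq_bigr => i _; rewrite /= mul2n. Qed.

(** Among the numbers below [q], [q./2] are odd and [uphalf q] are even; these are the side sizes of
    a balanced block. *)
Lemma sum_parity A B q :
  \sum_(a < q) (if odd a then A else B) = q./2 * A + uphalf q * B.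
Proof.
elim: q => [|q IH]; first by rewrite big_ord0.
rewrite big_ord_recr /= {}IH uphalf_half.
by case: (odd q) => /=; nia.
Qed.

Lemma half_mul_t q : q./2 * uphalf q = t q.
Proof.
rewrite /t -{3}[q]odd_double_half uphalf_half -mulnn.
by case: (odd q); move: q./2 => h; nia.
Qed.

Lemma half_sqr_s q : q./2 * q./2 + uphalf q * uphalf q = q + (s q).*2.
Proof.
case: q => // q; rewrite sS -half_mul_t /= uphalf_half.
by have := odd_double_half q; case: (odd q) => /=; nia.
Qed.

Lemma sum_diff_parity q : \sum_(a < q) \sum_(b < q) (odd a != odd b : nat) = (t q).*2.
Proof.
rewrite (eq_bigr (fun a : 'I_q => if odd a then uphalf q else q./2)) => [|a _].
  by rewrite sum_parity [uphalf q * _]mulnC addnn half_mul_t.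
have [oa|ea] := boolP (odd a).
  rewrite (eq_bigr (fun b : 'I_q => if odd b then 0 else 1)) => [|b _]; last by case: odd.
  by rewrite sum_parity; lia.
rewrite (eq_bigr (fun b : 'I_q => if odd b then 1 else 0)) => [|b _]; last by case: odd.
by rewrite sum_parity; lia.
Qed.

Lemma sum_same_parity q :
  \sum_(a < q) \sum_(b < q) ((a != b) && (odd a == odd b) : nat) = (s q).*2.
Proof.
(* Adding [q] restores the diagonal, so that the count becomes the sum of the squares of the side
   sizes. *)
apply/eqP; rewrite -(eqn_add2l q) -half_sqr_s -{1}[q]card_ord -sum1_card -big_split /=.
rewrite -sum_parity; apply/eqP/eq_bigr => a _.
have <- : \sum_(b < q) (odd a == odd b : nat) = (if odd a then q./2 else uphalf q).
  have [oa|ea] := boolP (odd a).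
    rewrite (eq_bigr (fun b : 'I_q => if odd b then 1 else 0)) => [|b _]; last by case: odd.
    by rewrite sum_parity; lia.
  rewrite (eq_bigr (fun b : 'I_q => if odd b then 0 else 1)) => [|b _]; last by case: odd.
  by rewrite sum_parity; lia.
rewrite (bigD1 a) //= [RHS](bigD1 a) //= !eqxx /= add0n; congr (_ + _).
by apply: eq_bigr => b nba; rewrite eq_sym nba.
Qed.

(** Pairs from different blocks contribute 0, so ordered counts in a disjoint union can be evaluated
    block by block. *)
Lemma sum_blocks k (q : 'I_k -> nat) (f : rel nat) :
  \sum_(u : {i : 'I_k & 'I_(q i)}) \sum_(v : {i : 'I_k & 'I_(q i)})
     ((tag u == tag v) && f (tagged u) (tagged v) : nat) =
  \sum_(i < k) \sum_(a < q i) \sum_(b < q i) (f a b : nat).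
Proof.
rewrite [RHS]sig_big_dep /=; apply: eq_bigr => -[i a] _ /=.
rewrite -(sig_big_dep predT (fun=> predT)
  (fun j (b : 'I_(q j)) => (i == j) && f a b : nat)) /=.
rewrite (bigD1 i) //= eqxx [X in _ + X]big1 ?addn0 // => j nji.
by rewrite big1 // => b _; rewrite eq_sym (negbTE nji).
Qed.

Lemma subset_of_card (T : finType) (A : {set T}) m :
  m <= #|A| -> exists2 B : {set T}, B \subset A & #|B| = m.
Proof.
move=> mA; exists [set x in take m (enum A)].
  by apply/subsetP => x; rewrite inE => /mem_take; rewrite mem_enum.
rewrite cardsE (card_uniqP _) ?take_uniq ?enum_uniq // size_take -cardE.
by case: ltngtP mA.
Qed.

(** * Subgraphs of disjoint unions of balanced complete bipartite graphs *)

Section BlockGraph.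
Variables (k : nat) (q : 'I_k -> nat).
Let T := {i : 'I_k & 'I_(q i)}.

(* The sides of a block are its even and its odd elements. *)
Definition block_adj (u v : T) := (tag u == tag v) && (odd (tagged u) != odd (tagged v)).

Lemma block_adj_sym : symmetric block_adj.
Proof. by move=> u v; rewrite /block_adj eq_sym [odd _ == _]eq_sym. Qed.

Lemma block_adj_irrefl : irreflexive block_adj.
Proof. by move=> u; rewrite /block_adj !eqxx. Qed.

Definition block_graph := SGraph block_adj_sym block_adj_irrefl.

Variable F : {set {set T}}.
Hypothesis FB : F \subset edges block_graph.

Definition sub_adj (u v : T) := (u != v) && ([set u; v] \in F).

Lemma sub_adj_sym : symmetric sub_adj.
Proof. by move=> u v; rewrite /sub_adj eq_sym setUC. Qed.

Lemma sub_adj_irrefl : irreflexive sub_adj.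
Proof. by move=> u; rewrite /sub_adj eqxx. Qed.

Definition sub_block_graph := SGraph sub_adj_sym sub_adj_irrefl.

Lemma sub_adj_block u v : sub_adj u v -> block_adj u v.
Proof.
case/andP=> nuv /(subsetP FB)/imset2P[x y _]; rewrite inE /= => xy.
by case/(set2_inj nuv) => -[-> ->] //; rewrite block_adj_sym.
Qed.

Lemma edges_sub_block_graph : edges sub_block_graph = F.
Proof.
apply/setP => E; apply/imset2P/idP => [[x y _]|EF].
  by rewrite inE => /andP[_ /andP[_ xyF]] ->.
have /imset2P[x y _ + Exy] := subsetP FB E EF; rewrite inE => /andP[_ xy].
exists x y; rewrite ?inE //= /sub_adj -Exy EF andbT.
by apply: contraTneq xy => ->; rewrite adj_irrefl.
Qed.

Lemma sub_block_triangle_free : triangle_free sub_block_graph.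
Proof.
apply/existsPn => x; apply/existsPn => y; apply/existsPn => z.
apply/negP => /and3P[/sub_adj_block/andP[_ xy] /sub_adj_block/andP[_ yz]].
move/sub_adj_block/andP=> [_]; move: xy yz.
by case: (odd (tagged x)); case: (odd (tagged y)); case: (odd (tagged z)).
Qed.

(** A path of length two stays in one block and changes side twice, so its ends are distinct
    vertices of the same side. *)
Lemma f3_sub_block_graph : f3_graph sub_block_graph <= \sum_(i < k) s (q i).
Proof.
rewrite -leq_double (double_f3 sub_block_triangle_free) sum_double.
rewrite (eq_bigr _ (fun i _ => esym (sum_same_parity (q i)))).
rewrite -(sum_blocks q (fun a b => (a != b) && (odd a == odd b))) npairsE.
rewrite big_mkcond; apply: leq_sum => x _; rewrite inE.
rewrite big_mkcond; apply: leq_sum => y _; rewrite inE.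
case: (boolP (dist2 _ _ _ _)) => // /andP[nxy /exists_inP[z _ /andP[]]].
move=> /sub_adj_block/andP[/eqP xz oxz] /sub_adj_block/andP[/eqP zy ozy].
have xy : tag x = tag y by rewrite xz.
have -> /= : tag x == tag y by rewrite xy.
have -> : odd (tagged x) == odd (tagged y).
  by move: oxz ozy; case: (odd (tagged x)); case: (odd (tagged y)); case: (odd (tagged z)).
rewrite andbT; have -> // : (tagged x : nat) != tagged y.
apply: contra nxy => /eqP; case: x y xy {xz oxz zy ozy} => [i a] [j b] /= ij.
by case: _ / ij b => b ab; apply/eqP; congr existT; apply: val_inj.
Qed.

End BlockGraph.

Lemma card_edges_block_graph k (q : 'I_k -> nat) :
  #|edges (block_graph q)| = \sum_(i < k) t (q i).
Proof.
apply: double_inj; rewrite double_edges sum_double.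
rewrite (eq_bigr _ (fun i _ => esym (sum_diff_parity (q i)))).
rewrite -(sum_blocks q (fun a b => odd a != odd b)) npairsE.
by apply: eq_big => [x|x _]; [|apply: eq_big => y]; rewrite ?inE.
Qed.

(** The block graph has at least [m] edges; any [m] of them may be kept. *)
Lemma graph_of_partition_cost n m u : partition_cost n m u ->
  exists G : sgraph, [/\ triangle_free G, #|G| = n, #|edges G| = m & f3_graph G <= u].
Proof.
case=> k [q [_ qn]]; rewrite -card_edges_block_graph => mle ->.
have [F FB <-] := subset_of_card mle.
exists (sub_block_graph F); split.
- exact: sub_block_triangle_free.
- rewrite /= card_tagged sumnE big_map -qn big_enum.
  by apply: eq_bigr => i _; rewrite card_ord.
- by rewrite edges_sub_block_graph.
- exact: f3_sub_block_graph.
Qed.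

(** * Existence and equality of the two minima *)

Lemma ex_minimum (A : nat -> Prop) u : A u -> exists v, is_minimum A v.
Proof.
elim/ltn_ind: u => u IH Au.
case: (classic (exists2 w, w < u & A w)) => [[w wu Aw]|no]; first exact: IH Aw.
exists u; split=> // w Aw; rewrite leqNgt; apply/negP => wu.
by apply: no; exists w.
Qed.

(* Equality of the two minima includes that both minima exist. *)
Theorem theorem1p4 (n m : nat) (hn : 1 <= n) (hm : m <= t n) :
  exists v : nat,
    is_f3 n m v /\
    is_minimum
      (fun u => exists (k : nat) (q : 'I_k -> nat),
         [/\ 0 < k /\ (forall i, 0 < q i),
             \sum_(i < k) q i = n,
             m <= \sum_(i < k) t (q i)
           & u = \sum_(i < k) s (q i)])
      v.
Proof.
(* The single part [n] is admissible by [hm]. *)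
have [|v vmin] := @ex_minimum (partition_cost n m) (s n).
  by exists 1, (fun=> n); rewrite !big_ord1.
exists v; split=> //; have [vP vle] := vmin.
have lower G : triangle_free G -> #|G| = n -> #|edges G| = m -> v <= f3_graph G.
  move=> tf Gn Gm; have [|u] := partition_cost_of_graph tf; first by rewrite Gn.
  by rewrite Gn Gm => /vle; apply: leq_trans.
(* This graph has at most [v] saturating pairs, and [lower] forces equality. *)
have [G [tf Gn Gm Gv]] := graph_of_partition_cost vP; split.
  by exists G; split=> //; apply/eqP; rewrite eqn_leq Gv lower.
by move=> _ [H [tfH Hn Hm ->]]; apply: lower.
Qed.
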